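(* Let $n$ be an integer with $2\le n\le 14$. Then $\mathbf{c}_n(\mathbb{R}^n)=\sqrt{n^n}$.
   Context: $\mathbb{R}^n$ carries the standard inner product $\langle\cdot,\cdot\rangle$ and Euclidean norm. For a Banach space $E$ with dual $E'$, and $\phi_1,\dots,\phi_n\in E'$, let $\phi_1\cdots\phi_n$ denote the pointwise product $x\mapsto \phi_1(x)\cdots\phi_n(x)$, with $\|\phi_1\cdots\phi_n\|=\sup_{\|x\|=1}|\phi_1(x)\cdots\phi_n(x)|$ (and $\|\phi_i\|$ is the usual dual norm). The $n$-th linear polarization constant of $E$ is $$\mathbf{c}_n(E)=\inf\{M>0:\ \|\phi_1\|\cdots\|\phi_n\|\le M\,\|\phi_1\cdots\phi_n\|\ \text{ for all } \phi_1,\dots,\phi_n\in E'\}$$ $$=1\Big/\inf\Big\{\sup_{\|x\|=1}|\phi_1(x)\cdots\phi_n(x)|:\ \phi_i\in E',\ \|\phi_i\|=1 \text{ for all } 1\le i\le n\Big\}.$$ *)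

(* Defs.v *)
From HB Require Import structures.
From mathcomp Require Import all_boot all_order all_algebra.
From mathcomp Require Import all_classical all_reals topology normedtype.
From mathcomp Require Import ring lra.

Set Implicit Arguments.
Unset Strict Implicit.
Unset Printing Implicit Defensive.

Import Order.TTheory GRing.Theory Num.Theory.
Import numFieldNormedType.Exports.

Local Open Scope classical_set_scope.
Local Open Scope ring_scope.

Section InnerProduct.
Variables (R : realType) (n : nat).
Implicit Types u v w : 'rV[R]_n.

Definition inner u v : R := \sum_(i < n) u 0 i * v 0 i.

Definition enorm u : R := Num.sqrt (inner u u).

Lemma innerC u v : inner u v = inner v u.
Proof. by apply: eq_bigr => i _; rewrite mulrC. Qed.

Lemma innerDl u v w : inner (u + v) w = inner u w + inner v w.
Proof. by rewrite -big_split; apply: eq_bigr => i _; rewrite mxE mulrDl. Qed.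

Lemma innerZl a u w : inner (a *: u) w = a * inner u w.
Proof. by rewrite mulr_sumr; apply: eq_bigr => i _; rewrite mxE mulrA. Qed.

Lemma inner_ge0 u : 0 <= inner u u.
Proof. by apply: sumr_ge0 => i _; rewrite -expr2 sqr_ge0. Qed.

Lemma inner_eq0 u : inner u u = 0 -> u = 0.
Proof.
move=> u0; apply/rowP => i; rewrite mxE; apply/eqP.
rewrite -sqrf_eq0 expr2; apply/eqP.
by apply: (psumr_eq0P _ u0) => // j _; rewrite -expr2 sqr_ge0.
Qed.

Lemma inner_CauchySchwarz u v : inner u v ^+ 2 <= inner u u * inner v v.
Proof.
have [v0|v0] := eqVneq (inner v v) 0.
  rewrite v0 mulr0 (inner_eq0 v0) innerC -(scale0r 0) innerZl mul0r.
  by rewrite expr0n.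
have vp : 0 < inner v v by rewrite lt_neqAle eq_sym v0 inner_ge0.
have := inner_ge0 (inner v v *: u + (- inner u v) *: v).
rewrite innerDl !innerZl !(innerC _ (_ + _)) !innerDl !innerZl (innerC v u).
set a := inner u u; set b := inner u v; set c := inner v v.
have -> : c * (c * a + - b * b) + - b * (c * b + - b * c)
  = c * (a * c - b ^+ 2) by ring.
by rewrite pmulr_rge0// subr_ge0.
Qed.

Lemma enormD u v : enorm (u + v) <= enorm u + enorm v.
Proof.
rewrite -(ger0_norm (addr_ge0 (sqrtr_ge0 (inner u u)) (sqrtr_ge0 (inner v v)))).
rewrite -sqrtr_sqr ler_sqrt ?sqr_ge0// sqrrD !sqr_sqrtr ?inner_ge0//.
rewrite innerDl !(innerC _ (_ + _)) !innerDl (innerC v u).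
have : inner u v <= enorm u * enorm v.
  rewrite (le_trans (ler_norm _))// -sqrtr_sqr -sqrtrM ?inner_ge0//.
  by rewrite ler_sqrt ?inner_CauchySchwarz// mulr_ge0 ?inner_ge0.
rewrite /enorm; lra.
Qed.

Lemma enormZ a u : enorm (a *: u) = `|a| * enorm u.
Proof.
rewrite /enorm innerZl innerC innerZl mulrA -expr2.
by rewrite sqrtrM ?sqr_ge0// sqrtr_sqr.
Qed.

Lemma enorm0_eq0 u : enorm u = 0 -> u = 0.
Proof.
move/eqP; rewrite sqrtr_eq0 => u0; apply: inner_eq0.
by apply: le_anti; rewrite u0 inner_ge0.
Qed.

Lemma ler_coord_enorm u i : `|u 0 i| <= enorm u.
Proof.
rewrite -sqrtr_sqr ler_sqrt ?inner_ge0// /inner (bigD1 i)//= -expr2 lerDl.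
by apply: sumr_ge0 => j _; rewrite -expr2 sqr_ge0.
Qed.

Lemma ler_enorm_sum u : enorm u <= \sum_(i < n) `|u 0 i|.
Proof.
have S0 (s : seq 'I_n) : 0 <= \sum_(i <- s) `|u 0 i|.
  by apply: sumr_ge0 => i _.
rewrite -(ger0_norm (S0 _)) -sqrtr_sqr ler_sqrt ?sqr_ge0// /inner.
elim: (index_enum _) => [|i s IH]; first by rewrite !big_nil expr0n.
rewrite !big_cons sqrrD (real_normK (num_real _)) -expr2 -addrA lerD2l.
by rewrite (le_trans IH)// lerDr mulrn_wge0// mulr_ge0.
Qed.

End InnerProduct.

(* R^n with the Euclidean norm. A separate name for 'rV[R]_n is needed because
   the library already equips 'rV[R]_n with the max norm. *)
Definition euclidean (R : realType) (n : nat) : Type := 'rV[R]_n.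

HB.instance Definition _ (R : realType) (n : nat) :=
  GRing.Lmodule.copy (euclidean R n) 'rV[R]_n.

HB.instance Definition _ (R : realType) (n : nat) :=
  Lmodule_isNormed.Build R (euclidean R n)
    (@enormD R n) (@enormZ R n) (@enorm0_eq0 R n).

Lemma euclidean_normE (R : realType) (n : nat) (x : euclidean R n) :
  `|x| = Num.sqrt (inner x x).
Proof. by []. Qed.

Section Complete.
Variables (R : realType) (n : nat).

Lemma euclidean_complete (F : set_system (euclidean R n)) :
  ProperFilter F -> cauchy F -> cvg F.
Proof.
move=> FF /cauchy_ballP Fc.
have /(_ _)/cauchy_cvg/cvg_ballP cvF :
    forall i, cauchy ((fun x : euclidean R n => (x : 'rV[R]_n) 0 i) @ F).
  move=> i; apply/cauchy_ballP => e e0.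
  rewrite near_simpl near_map2.
  apply: filterS (Fc _ e0) => -[x y] /=.
  rewrite -!ball_normE /ball_ /=; apply: le_lt_trans.
  by have := ler_coord_enorm (x - y) i; rewrite !mxE.
apply/cvg_ex.
pose l : 'rV[R]_n := \row_i lim ((fun x : euclidean R n => (x : 'rV[R]_n) 0 i) @ F).
exists (l : euclidean R n); apply/cvgrPdist_lt => e e0.
have d0 : 0 < e / n.+1%:R by rewrite divr_gt0.
near=> x.
apply: (le_lt_trans (ler_enorm_sum _)).
apply: (@le_lt_trans _ _ (\sum_(i < n) e / n.+1%:R)).
  apply: ler_sum => i _; rewrite !mxE; apply: ltW.
  move: i; near: x; apply: filter_forall => i.
  exact: (cvF i _ d0).
rewrite sumr_const card_ord -[_ *+ n]mulr_natr -mulrA gtr_pMr//.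
by rewrite mulrC ltr_pdivrMr// mul1r ltr_nat.
Unshelve. all: by end_near. Qed.

HB.instance Definition _ :=
  Uniform_isComplete.Build (euclidean R n) euclidean_complete.

End Complete.

Section PolarizationConstant.
Variables (R : realType) (E : completeNormedModType R).

(* E' is rendered as the linear maps E -> R^o satisfying [continuous]. The sets
   below are bounded above for continuous functionals, so [sup] is the genuine
   supremum. *)
Definition dual_norm (phi : {linear E -> R^o}) : R :=
  sup [set `|phi x : R| | x in [set x : E | `|x| <= 1]].

Definition prod_norm (n : nat) (phi : 'I_n -> {linear E -> R^o}) : R :=
  sup [set `|\prod_(i < n) (phi i x : R)| | x in [set x : E | `|x| = 1]].

Definition polarization_constant (n : nat) : R :=
  inf [set M : R | 0 < M /\
    forall phi : 'I_n -> {linear E -> R^o}, (forall i, continuous (phi i)) ->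
      \prod_(i < n) dual_norm (phi i) <= M * prod_norm phi].

End PolarizationConstant.

Arguments polarization_constant {R} E n.

(* Main.v *)
From HB Require Import structures.
Require Import Defs.
From mathcomp Require Import all_boot all_order all_algebra.
From mathcomp Require Import all_classical all_reals topology normedtype.
From mathcomp Require Import interval_inference sequences derive realfun.
From mathcomp Require Import exp convex.
From mathcomp Require Import ring lra.

Set Implicit Arguments.
Unset Strict Implicit.
Unset Printing Implicit Defensive.

Import Order.TTheory GRing.Theory Num.Theory.
Import numFieldNormedType.Exports.

Local Open Scope ring_scope.

(** Identifying functionals with vectors, the theorem says that vectors
[v_1, ..., v_n] of [R^n] admit a unit vector [x] with
[prod |v_i| <= sqrt(n^n) * prod |<x, v_i>|], and that the constant
[sqrt(n^n)] is optimal. Optimality is seen on the coordinate functionals: by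
the arithmetic-geometric inequality, [prod x_i ^ 2 <= n^-n] on the sphere.

For the inequality, take the [v_i] to be unit vectors and, as in Bang's proof
of the plank theorem, choose signs that maximise the norm of
[s = sum e_i v_i]. Put [a_i = <e_i v_i, s>] and [M = |s|]. Flipping one sign
does not increase the norm, which gives [a_i >= 1]; Cauchy-Schwarz gives
[a_i <= M]; and the [a_i] add up to [M ^ 2]. With [x = s / M] everything
reduces to a statement on [n] real numbers ([expn_le_prod]):
[t ^ n <= prod a_i], where [t = M / sqrt n >= 1].

This is where [n <= 14] enters. The logarithm being concave, the product is
smallest when all but one of the [a_i] are [1] or [M]. The two regimes, one
exceptional value near [1] or several values equal to [M], are covered by two
lower bounds which cross near [t = 1.1]:
- Bernoulli: [prod a_i >= 1 + sum (a_i - 1) = 1 + n (t ^ 2 - 1)], which is at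
  least [t ^ n] for [t <= 2209/2000] ([expn_le_affine_sqr]);
- the chord of the logarithm from [1] to [M]:
  [ln a_i >= (a_i - 1) / (M - 1) * ln M]. Summing, and writing
  [ln M = ln n / 2 + ln t], the required inequality becomes
  [2 t (sqrt n - t) ln t <= (t ^ 2 - 1) ln n]. As
  [2 t ln t <= t ^ 2 - 1], it holds as soon as [sqrt n - t <= ln n], which
  is true for [t >= 2209/2000] ([sqrt_sub_ln_le]).
For [n = 14] both ranges are nearly sharp: the first bound holds up to about
[1.107], and the second argument starts at about [1.1026]; for [n = 15] a gap
opens between them. This is why [ln 14] is needed with some precision. *)

(** * Estimates for the logarithm *)

Section LogarithmBounds.
Variable R : realType.
Implicit Types a t x : R.

Lemma ge_at1_of_derive_ge0 (f f' : R -> R) :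
    (forall x, 1 <= x -> is_derive x 1 f (f' x)) ->
    (forall x, 1 <= x -> 0 <= f' x) ->
  forall x, 1 <= x -> f 1 <= f x.
Proof.
move=> df f'0 x x1.
apply: (@ger0_derive1_ndecr _ f 1 x) => //.
- by move=> y; rewrite in_itv/= => /andP[/ltW/df[]].
- move=> y; rewrite in_itv/= => /andP[/ltW y1 _].
  by have [_ Df] := df _ y1; rewrite derive1E Df f'0.
- apply: derivable_within_continuous => y.
  by rewrite in_itv/= => /andP[/df[]].
Qed.

(** For [t = e ^ u] this is [u <= sinh u]. It is exact to second order at
[1], which the argument needs because the product inequality is an equality
at [t = 1]. *)
Lemma mulr_ln_le_sqr_sub1 t : 1 <= t -> 2 * t * ln t <= t ^+ 2 - 1.
Proof.
move=> t1; suff : ln t <= (t - t^-1) / 2.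
  rewrite -(@ler_pM2l _ (2 * t)) => [|]; last by lra.
  have -> // : 2 * t * ((t - t^-1) / 2) = t ^+ 2 - 1 by field; lra.
rewrite -subr_ge0.
have -> : 0 = (1 - 1^-1) / 2 - ln (1 : R) by rewrite ln1; field.
pose f (x : R) := (x - x^-1) / 2 - ln x.
pose f' (x : R) := (1 + x ^- 2) / 2 - x^-1.
apply: (@ge_at1_of_derive_ge0 f f') => // x x1.
- have x0 : 0 < x by lra.
  have xN0 : x != 0 by rewrite gt_eqF.
  have dV := @is_deriveV R id x 1 1 xN0 (is_derive_id x 1).
  have dl := is_derive1_ln x0.
  apply: is_derive_eq => /=; rewrite /f' /GRing.scale/=; field; lra.
- have xV1 : x^-1 <= 1 by rewrite invf_le1//; lra.
  rewrite /f' -exprVn; nra.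
Qed.

(** A Pade approximant of [ln] at [1]: for [x = e ^ u] this is
[tanh (u / 2) <= u / 2]. Its error is of third order in [x - 1], so a few
factors close to [1] suffice for the numerical bounds below. *)
Lemma ln_ge_pade x : 1 <= x -> 2 * (x - 1) <= ln x * (x + 1).
Proof.
move=> x1; rewrite -ler_pdivrMr; last by lra.
rewrite -subr_ge0.
have -> : 0 = ln (1 : R) - 2 * (1 - 1) / (1 + 1) by rewrite ln1; field.
pose f (y : R) := ln y - 2 * (y - 1) / (y + 1).
pose f' (y : R) := (y - 1) ^+ 2 / (y * (y + 1) ^+ 2).
apply: (@ge_at1_of_derive_ge0 f f') => // y y1.
- have y0 : 0 < y by lra.
  have yN0 : y + 1 != 0 by rewrite gt_eqF//; lra.
  have dV := @is_deriveV R (fun z => z + 1) y _ 1 yN0 _.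
  have dl := is_derive1_ln y0.
  apply: is_derive_eq => /=; rewrite /f' /GRing.scale/=; field.
  by apply/andP; split => //; rewrite gt_eqF.
- by rewrite divr_ge0 ?sqr_ge0// mulr_ge0 ?sqr_ge0//; lra.
Qed.

(** Concavity. The bound is exact at both ends of the interval, which is where
the extremal values of the product inequality lie. *)
Lemma ln_ge_chord X a : 1 < X -> 1 <= a <= X ->
  (a - 1) / (X - 1) * ln X <= ln a.
Proof.
move=> X1 /andP[a1 aX].
have X10 : 0 < X - 1 by lra.
have t0 : 0 <= (X - a) / (X - 1) by rewrite divr_ge0//; lra.
have t1 : (X - a) / (X - 1) <= 1 by rewrite ler_pdivrMr//; lra.
have X0 : 0 < X by lra.
have := @concave_ln R (Itv01 t0 t1) 1 X ltr01 X0.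
rewrite !convRE/= ln1 mulr0 add0r /unstable.onem.
have -> : 1 - (X - a) / (X - 1) = (a - 1) / (X - 1) by field; lra.
have -> // : (X - a) / (X - 1) * 1 + (a - 1) / (X - 1) * X = a by field; lra.
Qed.

(** The classical decomposition
[ln 2 = 7 ln (16/15) + 5 ln (25/24) + 3 ln (81/80)] writes [2] as a product
of ratios near [1]. It is obtained by solving for [ln 2], [ln 3], [ln 5]; the
product itself, with its large numerators, is never expanded. *)
Lemma ln2_ge : 97 / 140 <= ln (2 : R).
Proof.
have pow (b k : nat) : (0 < b)%N -> ln ((b ^ k)%:R : R) = k%:R * ln b%:R.
  by move=> b0; rewrite natrX lnXn ?ltr0n// mulr_natl.
have prod (a b : nat) : (0 < a)%N -> (0 < b)%N ->
    ln ((a * b)%:R : R) = ln a%:R + ln b%:R.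
  by move=> a0 b0; rewrite natrM lnM ?posrE ?ltr0n.
have quot (a b : nat) : (0 < a)%N -> (0 < b)%N ->
    ln (a%:R / b%:R : R) = ln a%:R - ln b%:R.
  by move=> a0 b0; rewrite ln_div ?posrE ?ltr0n.
have l16 := quot 16%N 15%N isT isT; have l25 := quot 25%N 24%N isT isT.
have l81 := quot 81%N 80%N isT isT.
rewrite (pow 2%N 4%N)// (prod 3%N 5%N)// in l16.
rewrite (pow 5%N 2%N)// (prod 8%N 3%N)// (pow 2%N 3%N)// in l25.
rewrite (pow 3%N 4%N)// (prod 16%N 5%N)// (pow 2%N 4%N)// in l81.
have b16 := @ln_ge_pade (16 / 15) ltac:(lra).
have b25 := @ln_ge_pade (25 / 24) ltac:(lra).
have b81 := @ln_ge_pade (81 / 80) ltac:(lra).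
lra.
Qed.

(** [14 = 2 ^ 4 * (7/8)]. The bound is [sqrt 14 - 2209/2000] with [sqrt 14]
rounded up to [1871/500]. *)
Lemma ln14_ge : 211 / 80 <= ln (14 : R).
Proof.
have -> : 14 = 2 ^+ 4 / (8 / 7) :> R by field.
rewrite ln_div ?posrE ?exprn_gt0 ?lnXn//.
have := @mulr_ln_le_sqr_sub1 (8 / 7) ltac:(lra); have := ln2_ge.
rewrite -[ln 2 *+ 4]mulr_natl; lra.
Qed.

(** [x - 2 ln x] is convex, so its maximum on the interval from [1] to
[sqrt 14] is reached at an endpoint: it is [1] at [1], and the bound on
[ln 14] handles the other. *)
Lemma sub_2ln_le x : 1 <= x -> x ^+ 2 <= 14 -> x - 2 * ln x <= 2209 / 2000.
Proof.
move=> x1 x14; have [X X0 X2] : exists2 X : R, 0 < X & X ^+ 2 = 14.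
  by exists (Num.sqrt 14); rewrite ?sqrtr_gt0// sqr_sqrtr.
have lX : 211 / 80 <= 2 * ln X.
  by rewrite [2 * _]mulr_natl -lnXn// X2 ln14_ge.
have Xu : X <= 1871 / 500 by nra.
have xX : x <= X by nra.
have Xl : 3 <= X by nra.
have chord : (x - 1) * ln X <= ln x * (X - 1).
  by rewrite -ler_pdivrMr 1?mulrAC ?ln_ge_chord ?x1 ?xX//; lra.
have X10 : 0 < X - 1 by lra.
(* Times [X - 1], the claim is the interpolation between its two endpoint
   cases; [slope] is the one at [X] and [gap] the slack of the one at [1]. *)
rewrite -(ler_pM2r X10).
have slope : (x - 1) * (X - 2209 / 2000) <= (x - 1) * (2 * ln X).
  by apply: ler_wpM2l; lra.
have gap : 0 <= (2209 / 2000 - 1) * (X - x) by apply: mulr_ge0; lra.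
move: (ln x) (ln X) chord slope gap => l lX' chord slope gap.
clear - chord slope gap; lra.
Qed.

Lemma sqrt_sub_ln_le (n : nat) : (1 <= n <= 14)%N ->
  Num.sqrt n%:R - ln n%:R <= 2209 / 2000 :> R.
Proof.
move=> /andP[n1 n14].
have s1 : 1 <= Num.sqrt n%:R :> R by rewrite -[leLHS]sqrtr1 ler_sqrt ?ler1n.
have s2 : Num.sqrt n%:R ^+ 2 = n%:R :> R by rewrite sqr_sqrtr.
have -> : ln n%:R = 2 * ln (Num.sqrt n%:R) :> R.
  by rewrite -[in LHS]s2 lnXn ?[2 * _]mulr_natl// (lt_le_trans _ s1).
by apply: sub_2ln_le; rewrite ?s2 ?ler_nat.
Qed.

End LogarithmBounds.

(** * The inequality for n real numbers *)

Section ProductInequality.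
Variable R : realType.
Implicit Types t M : R.

Lemma prod_1D_ge (I : Type) (r : seq I) (b : I -> R) :
  (forall i, 0 <= b i) -> 1 + \sum_(i <- r) b i <= \prod_(i <- r) (1 + b i).
Proof.
move=> b0; elim: r => [|i r IH]; first by rewrite !big_nil addr0.
rewrite !big_cons; have S0 : 0 <= \sum_(j <- r) b j by rewrite sumr_ge0.
have := b0 i; nra.
Qed.

(** [(t ^ n - 1) / n] is, up to the factor [t - 1], the mean of
[1, t, ..., t ^ (n - 1)], and the mean of a nondecreasing sequence is
nondecreasing. This reduces the Bernoulli regime to [n = 14]. *)
Lemma subX1_mean_le t (k n : nat) : 1 <= t -> (k <= n)%N ->
  n%:R * (t ^+ k - 1) <= k%:R * (t ^+ n - 1).
Proof.
move=> t1 /subnK <-; elim: (n - k)%N => [|d IH]; first by rewrite add0n.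
have step : t ^+ k - 1 <= k%:R * (t ^+ (d + k) * (t - 1)).
  rewrite subrX1 mulrC mulrA ler_wpM2r ?subr_ge0//.
  have -> : k%:R * t ^+ (d + k) = \sum_(i < k) t ^+ (d + k).
    by rewrite sumr_const card_ord mulr_natl.
  by apply: ler_sum => i _; rewrite ler_weXn2l// ltnW// ltn_addl.
rewrite addSn -natr1 exprS; nra.
Qed.

(** By [subX1_mean_le] only [n = 14] matters, that is
[m ^ 7 - 1 <= 14 (m - 1)] with [m = t ^ 2 <= 61/50]: the quotient
[1 + m + ... + m ^ 6] is at most its value at [61/50], about [13.74]. *)
Lemma expn_le_affine_sqr t (n : nat) : (n <= 14)%N ->
  1 <= t <= 2209 / 2000 -> t ^+ n <= 1 + n%:R * (t ^+ 2 - 1).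
Proof.
move=> n14 /andP[t1 tT]; have mean := subX1_mean_le t1 n14.
have y0 : 0 <= t ^+ 2 - 1 by nra.
have yT : t ^+ 2 <= 61 / 50 by nra.
suff t14 : t ^+ 14 - 1 <= 14 * (t ^+ 2 - 1).
  have n0 : 0 <= n%:R :> R by [].
  nra.
rewrite (exprM t 2 7) subrX1 mulrC ler_wpM2r//.
apply: (@le_trans _ _ (\sum_(i < 7) (61 / 50) ^+ i)).
  by apply: ler_sum => i _; rewrite lerXn2r ?nnegrE ?sqr_ge0//; lra.
rewrite !big_ord_recl big_ord0 /= /bump /=; lra.
Qed.

(** The core of the proof. Under these constraints the minimum of the product
lies at points where all but one of the [a i] are [1] or [M]; for [n <= 14]
the two bounds used here are good enough to avoid locating it. *)
Lemma expn_le_prod (n : nat) (a : 'I_n -> R) M : (2 <= n <= 14)%N ->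
    (forall i, 1 <= a i <= M) -> \sum_i a i = M ^+ 2 ->
  M ^+ n <= Num.sqrt ((n ^ n)%:R) * \prod_i a i.
Proof.
move=> /andP[n2 n14] aM sa.
have i0 : 'I_n by case: n n2 {n14 a aM sa} => // n _; exact: ord0.
have M1 : 1 <= M by have /andP[] := aM i0; exact: le_trans.
have n2R : 2 <= n%:R :> R by rewrite ler_nat.
set s := Num.sqrt (n%:R : R).
have s0 : 0 < s by rewrite sqrtr_gt0; lra.
have s2 : s ^+ 2 = n%:R by rewrite sqr_sqrtr//; lra.
have -> : Num.sqrt (n ^ n)%:R = s ^+ n.
  apply/eqP; rewrite -(@eqrXn2 _ 2)// ?sqrtr_ge0 ?exprn_ge0 ?(ltW s0)//.
  by rewrite sqr_sqrtr// natrX exprAC s2.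
pose t := M / s.
have Mst : M = s * t by rewrite /t mulrC divfK// gt_eqF.
have dev : \sum_i (a i - 1) = n%:R * (t ^+ 2 - 1).
  by rewrite sumrB sa sumr_const card_ord Mst exprMn s2 mulrBr mulr1.
have dev0 : 0 <= \sum_i (a i - 1).
  by apply: sumr_ge0 => i _; rewrite subr_ge0; case/andP: (aM i).
have t0 : 0 < t by rewrite divr_gt0//; lra.
have t1 : 1 <= t by rewrite dev pmulr_rge0 in dev0; nra.
rewrite Mst exprMn ler_pM2l ?exprn_gt0//.
have [tT|/ltW tT] := leP t (2209 / 2000).
  apply: le_trans (expn_le_affine_sqr n14 _) _; first by rewrite t1.
  rewrite -dev; apply: le_trans (prod_1D_ge _ _) _ => [i|].
    by rewrite subr_ge0; case/andP: (aM i).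
  by rewrite (eq_bigr a) // => i _; rewrite addrC subrK.
(* From here on [t] is large, and each [a i] is bounded below by the point of
   the exponential curve which corresponds to the chord of [ln]. *)
have M10 : 0 < M - 1 by nra.
pose c := ln M / (M - 1).
apply: (@le_trans _ _ (\prod_i expR ((a i - 1) * c))); last first.
  apply: ler_prod => i _; rewrite expR_ge0/=.
  have ai0 : 0 < a i by case/andP: (aM i) => ? _; lra.
  rewrite -[leRHS]lnK// ler_expR /c mulrA mulrAC.
  by apply: ln_ge_chord (aM i); lra.
rewrite -expR_sum -mulr_suml dev.
rewrite -[leLHS]lnK ?posrE ?exprn_gt0// ler_expR lnXn//.
rewrite -[ln t *+ n]mulr_natl -mulrA ler_wpM2l// /c mulrA ler_pdivlMr//.
have lM : ln M = ln n%:R / 2 + ln t.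
  by rewrite Mst lnM ?posrE// -s2 lnXn// -[ln s *+ 2]mulr_natl//; field.
have l0 : 0 <= ln t by rewrite ln_ge0.
have L0 : 0 <= ln (n%:R : R) by rewrite ln_ge0//; lra.
have lt := mulr_ln_le_sqr_sub1 t1.
have sL : s - t <= ln n%:R.
  have := @sqrt_sub_ln_le R n; rewrite n14 (ltnW n2) => /(_ isT).
  rewrite -/s; lra.
(* With [l = ln t] and [L = ln n], the goal rearranges to
   [l t (s - t) <= (t ^ 2 - 1) L / 2]. *)
rewrite lM Mst; set l := ln t in l0 lt *; set L := ln _ in L0 sL *.
have : l * t * (s - t) <= l * t * L by rewrite ler_wpM2l// mulr_ge0// ltW.
have : 2 * t * l * L <= (t ^+ 2 - 1) * L by rewrite ler_wpM2r.
lra.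
Qed.

End ProductInequality.

(** * Bang signs and the unit vector *)

Section Vectors.
Variables (R : realType) (n : nat).
Implicit Types (u v w x : 'rV[R]_n).

Lemma inner_suml (I : Type) (r : seq I) (u : I -> 'rV[R]_n) w :
  inner (\sum_(i <- r) u i) w = \sum_(i <- r) inner (u i) w.
Proof.
elim: r => [|i r IH]; last by rewrite !big_cons innerDl IH.
by rewrite !big_nil -(scale0r 0) innerZl mul0r.
Qed.

Lemma enorm_ge0 u : 0 <= enorm u.
Proof. exact: sqrtr_ge0. Qed.

Lemma sqr_enorm u : enorm u ^+ 2 = inner u u.
Proof. by rewrite sqr_sqrtr// inner_ge0. Qed.

Lemma normr_inner_le u v : `|inner u v| <= enorm u * enorm v.
Proof.
rewrite -(@ler_pXn2r _ 2)// ?nnegrE ?mulr_ge0 ?enorm_ge0//.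
by rewrite real_normK ?num_real// exprMn !sqr_enorm inner_CauchySchwarz.
Qed.

(** Choose the signs that maximise the norm of [S = sum e_j u_j]. Flipping
the sign in [w = e_i u_i] changes [|S|^2] by [4 - 4 <w, S>], which cannot be
positive. *)
Lemma bang_signs (m : nat) (u : 'I_m -> 'rV[R]_n) :
    (forall i, enorm (u i) = 1) ->
  exists e : 'I_m -> bool, forall i,
    1 <= inner ((-1) ^+ e i *: u i) (\sum_j (-1) ^+ e j *: u j).
Proof.
move=> u1; pose S (e : {ffun 'I_m -> bool}) := \sum_j (-1) ^+ e j *: u j.
pose e0 : {ffun 'I_m -> bool} := [ffun=> false].
have [e _ emax] := @arg_maxP _ _ _ e0 predT (fun e => inner (S e) (S e)) isT.
exists e => i; pose w := (-1) ^+ e i *: u i.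
pose e' := [ffun j => if j == i then ~~ e i else e j].
have Se' : S e' = S e + (- 2) *: w.
  rewrite /S (bigD1 i)//= [in RHS](bigD1 i)//= ffunE eqxx.
  have -> : \sum_(j | j != i) (-1) ^+ e' j *: u j
      = \sum_(j | j != i) (-1) ^+ e j *: u j.
    by apply: eq_bigr => j /negPf ji; rewrite ffunE ji.
  rewrite addrAC -/w; congr (_ + _).
  rewrite /w scalerA -scalerDl signrN; congr (_ *: _); ring.
have ww : inner w w = 1.
  by rewrite -sqr_enorm enormZ normr_sign mul1r u1 expr1n.
have := emax e' isT; rewrite Se' /= innerDl (innerZl (- 2)).
rewrite !(innerC _ (S e + _)) !innerDl !(innerZl (- 2)) ww (innerC (S e) w).
rewrite -/w -/(S e); lra.
Qed.

End Vectors.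

(** The normalised sum of the signed vectors is the required point: its
products with the [v i] are [|v i| * a_i / M] up to sign, so
[expn_le_prod] applies. *)
Lemma exists_unit_prod_inner_ge (R : realType) (n : nat)
    (v : 'I_n -> 'rV[R]_n) : (2 <= n <= 14)%N ->
  exists2 x : 'rV[R]_n, enorm x = 1 &
    \prod_i enorm (v i) <= Num.sqrt (n ^ n)%:R * `|\prod_i inner x (v i)|.
Proof.
move=> hn; have n0 : (0 < n)%N by case/andP: hn => /ltnW.
wlog v0 : v / forall i, enorm (v i) != 0.
  move=> W; have [/forallP v0|] := boolP [forall i, enorm (v i) != 0].
    exact: W.
  move=> /forallPn[i]; rewrite negbK => /eqP vi.
  (* If some [v i] vanishes, any unit vector will do; one is obtained from
     the nonvanishing case. *)
  have [|x x1 _] := W (fun=> delta_mx 0 (Ordinal n0)).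
    move=> _; rewrite sqrtr_eq0 -ltNge /inner (bigD1 (Ordinal n0))//=.
    rewrite !mxE !eqxx mulr1 ltr_wpDr// sumr_ge0// => j _.
    by rewrite -expr2 sqr_ge0.
  exists x => //; rewrite (bigD1 i)//= vi mul0r.
  by rewrite mulr_ge0 ?sqrtr_ge0.
have vp i : 0 < enorm (v i) by rewrite lt_neqAle eq_sym v0 enorm_ge0.
pose u i := (enorm (v i))^-1 *: v i.
have u1 i : enorm (u i) = 1.
  by rewrite enormZ gtr0_norm ?invr_gt0// mulVf.
have [e he] := bang_signs u1.
set s := \sum_j _ in he; pose w i := (-1) ^+ e i *: u i.
have w1 i : enorm (w i) = 1 by rewrite enormZ normr_sign mul1r.
have sa : \sum_i inner (w i) s = enorm s ^+ 2 by rewrite -inner_suml sqr_enorm.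
have ws i : 1 <= inner (w i) s <= enorm s.
  rewrite he/= (le_trans (ler_norm _))// (le_trans (normr_inner_le _ _))//.
  by rewrite w1 mul1r.
have key := expn_le_prod hn ws sa.
have s1 : 1 <= enorm s by have /andP[] := ws (Ordinal n0); exact: le_trans.
have sp : 0 < enorm s by lra.
have xv i : `|inner ((enorm s)^-1 *: s) (v i)|
    = enorm (v i) * (enorm s)^-1 * inner (w i) s.
  have vE : v i = (enorm (v i) * (-1) ^+ e i) *: w i.
    rewrite /w scalerA -mulrA -signr_addb addbb mulr1.
    by rewrite /u scalerA mulfV// scale1r.
  rewrite {1}vE innerZl innerC innerZl !normrM normr_sign mulr1.
  rewrite !gtr0_norm ?invr_gt0//; last by case/andP: (ws i) => ? _; lra.
  by rewrite mulrA [_^-1 * _]mulrC.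
exists ((enorm s)^-1 *: s).
  by rewrite enormZ gtr0_norm ?invr_gt0// mulVf// gt_eqF.
rewrite normr_prod (eq_bigr _ (fun i _ => xv i)) !big_split/=.
rewrite prodr_const card_ord exprVn.
set P := \prod_i enorm _; have P0 : 0 <= P.
  by apply: prodr_ge0 => i _; apply: enorm_ge0.
rewrite -!mulrA !(mulrCA _ P); apply: ler_peMr => //.
by rewrite mulrCA ler_pdivlMl ?exprn_gt0// mulr1.
Qed.

(** * Functionals as vectors *)

Section Functionals.
Variables (R : realType) (n : nat).
Implicit Type phi : {linear euclidean R n -> R^o}.

Definition riesz phi : 'rV[R]_n := \row_i phi ('e_i : 'rV[R]_n).

Lemma rieszE phi (x : euclidean R n) : phi x = inner x (riesz phi).
Proof.
rewrite [in LHS](row_sum_delta (x : 'rV[R]_n)) linear_sum.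
by apply: eq_bigr => i _; rewrite linearZ !mxE.
Qed.

Lemma norm_functional_le phi (x : euclidean R n) :
  `|phi x : R| <= `|x| * enorm (riesz phi).
Proof. by rewrite rieszE normr_inner_le. Qed.

Lemma dual_norm_le_riesz phi : dual_norm phi <= enorm (riesz phi).
Proof.
apply: ge_sup.
  by exists `|phi 0 : R|; exists 0 => //=; rewrite normr0.
move=> _ [x /= x1 <-]; apply: le_trans (norm_functional_le _ _) _.
by rewrite ler_piMl ?enorm_ge0.
Qed.

Lemma norm_functional_le_dual_norm phi (x : euclidean R n) :
  `|x| <= 1 -> `|phi x : R| <= dual_norm phi.
Proof.
move=> x1; apply: sup_upper_bound; last by exists x.
split; first by exists `|phi x : R|; exists x.
exists (enorm (riesz phi)) => _ [y /= y1 <-].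
apply: le_trans (norm_functional_le _ _) _.
by rewrite ler_piMl ?enorm_ge0.
Qed.

Lemma prod_functional_le_prod_norm (m : nat)
    (phi : 'I_m -> {linear euclidean R n -> R^o}) (x : euclidean R n) :
  `|x| = 1 -> `|\prod_i (phi i x : R)| <= prod_norm phi.
Proof.
move=> x1; apply: sup_upper_bound; last by exists x.
split; first by exists `|\prod_i (phi i x : R)|; exists x.
exists (\prod_i enorm (riesz (phi i))) => _ [y /= y1 <-].
rewrite normr_prod; apply: ler_prod => i _; rewrite normr_ge0/=.
by apply: le_trans (norm_functional_le _ _) _; rewrite y1 mul1r.
Qed.

Definition coordinate (i : 'I_n) (x : euclidean R n) : R^o :=
  (x : 'rV[R]_n) 0 i.

Lemma coordinate_is_linear i : linear (coordinate i).
Proof. by move=> a x y; rewrite /coordinate !mxE. Qed.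

HB.instance Definition _ i :=
  GRing.isLinear.Build R (euclidean R n) R^o _ (coordinate i)
    (coordinate_is_linear i).

Lemma continuous_coordinate i : continuous (coordinate i).
Proof.
move=> x A /nbhs_ballP[e /= e0 eA]; apply/nbhs_ballP; exists e => //= y xy.
apply: eA; move: xy; rewrite -!ball_normE /ball_/=; apply: le_lt_trans.
by have := ler_coord_enorm (x - y) i; rewrite !mxE.
Qed.

Lemma enorm_delta (i : 'I_n) : enorm ('e_i : 'rV[R]_n) = 1.
Proof.
rewrite /enorm /inner (bigD1 i)//= big1 => [|j /negPf ji].
  by rewrite !mxE !eqxx mulr1 addr0 sqrtr1.
by rewrite !mxE ji andbF mul0r.
Qed.

(** The arithmetic-geometric inequality for the squares of the coordinates,
whose sum is [1] on the unit sphere. *)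
Lemma prod_norm_coordinate_le : (0 < n)%N ->
  prod_norm (fun i => coordinate i : {linear euclidean R n -> R^o})
    <= (Num.sqrt (n ^ n)%:R)^-1.
Proof.
move=> n0; apply: ge_sup.
  pose x : euclidean R n := 'e_(Ordinal n0).
  exists `|\prod_i (coordinate i x : R)|; exists x => //=.
  exact: enorm_delta.
move=> _ [x /= x1 <-].
have nR : 0 < n%:R :> R by rewrite ltr0n.
rewrite -(@ler_pXn2r _ 2)// ?nnegrE ?invr_ge0 ?sqrtr_ge0//.
rewrite exprVn sqr_sqrtr// normr_prod -prodrXl natrX -exprVn.
have := @leif_AGM R 'I_n predT (fun i => `|coordinate i x : R| ^+ 2).
rewrite card_ord => /(_ (fun i _ => exprn_ge0 2 (normr_ge0 _)))[+ _].
suff -> : \sum_(i in predT) `|coordinate i x : R| ^+ 2 = 1 by rewrite div1r.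
rewrite -[RHS](expr1n _ 2) -x1 sqr_enorm; apply: eq_bigr => i _.
by rewrite real_normK ?num_real// expr2.
Qed.

End Functionals.

(** * The polarization constant *)

Theorem theorem3p1 (R : realType) (n : nat) (hn : (2 <= n <= 14)%N) :
  polarization_constant (euclidean R n) n = Num.sqrt ((n ^ n)%:R : R).
Proof.
have n0 : (0 < n)%N by case/andP: hn => /ltnW.
have c0 : 0 < Num.sqrt ((n ^ n)%:R : R) by rewrite sqrtr_gt0 ltr0n expn_gt0 n0.
rewrite /polarization_constant; set admissible := (A in inf A).
have in_admissible : admissible (Num.sqrt (n ^ n)%:R).
  split=> // phi _.
  have [x x1 hx] := exists_unit_prod_inner_ge (fun i => riesz (phi i)) hn.
  apply: (@le_trans _ _ (\prod_i enorm (riesz (phi i)))).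
    apply: ler_prod => i _; rewrite dual_norm_le_riesz andbT.
    apply: le_trans (norm_functional_le_dual_norm (x := 0) _ _) => //.
    by rewrite normr0.
  apply: le_trans hx _; rewrite ler_pM2l//.
  have -> : \prod_i inner x (riesz (phi i)) = \prod_i (phi i x : R).
    by apply: eq_bigr => i _; rewrite rieszE.
  exact: prod_functional_le_prod_norm.
apply/le_anti/andP; split.
  by apply: ge_inf => //; exists 0 => M [/ltW].
apply: lb_le_inf; first by exists (Num.sqrt (n ^ n)%:R).
move=> M [M0 /(_ (fun i => coordinate i : {linear euclidean R n -> R^o}))].
move=> /(_ (@continuous_coordinate R n)) hM.
rewrite -[leLHS]mul1r -ler_pdivlMr//.
apply: le_trans (_ : M * prod_norm _ <= _); last first.
  by rewrite ler_pM2l//; exact: prod_norm_coordinate_le.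
apply: le_trans hM; apply: (@le_trans _ _ (\prod_(i < n) 1)).
  by rewrite big1_eq.
apply: ler_prod => i _; rewrite ler01/=.
pose x : euclidean R n := 'e_i.
have x1 : `|x| <= 1 by rewrite euclidean_normE -/(enorm x) enorm_delta.
have := norm_functional_le_dual_norm (coordinate i) x1.
have xi : coordinate i x = 1 by rewrite /coordinate mxE !eqxx.
by rewrite /= xi normr1.
Qed.
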